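(* Let $B(z,u,v)=\sum_D z^{|D|-1}u^{\mathrm{top}(D)}v^{\mathrm{cr}(D)}$, the sum running over all rooted indecomposable chord diagrams $D$, and let $C(z,u,v)$ be the same sum restricted to connected chord diagrams. Then $$B(z,u,v)=u+z\,B(z,1+uv,v)\,B(z,u,v),$$ $$C(z,u,v)=u+z\big(C(z,1+uv,v)-C(z,1,v)\big)\,C(z,u,v).$$
   Context: A rooted chord diagram of size $|D|=n$ is a perfect matching of $\{0<\dots<2n-1\}$ into $n$ chords $(a,b)$, $a<b$, up to isomorphism. Chords $(a,b),(c,d)$ cross if $a<c<b<d$ or $c<a<d<b$; $\mathrm{cr}(D)$ is the number of unordered crossing pairs. A chord $(a,b)$ is below $(c,d)$ if $c<a<b<d$; a top chord is a chord not below any other chord, and $\mathrm{top}(D)$ is their number. A diagram is connected if its crossing graph on chords is connected, and indecomposable if it is not the side-by-side concatenation of two nonempty diagrams. *)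

(* Defs.v *)
From mathcomp Require Import all_boot all_order all_algebra.
Set Implicit Arguments. Unset Strict Implicit. Unset Printing Implicit Defensive.
Import GRing.Theory.

(* A rooted chord diagram of size n is a perfect matching of the linearly
   ordered set {0 < ... < 2n-1} = 'I_(2*n), encoded as a fixed-point-free
   involution f.  (Since the ground set is linearly ordered and rooted,
   isomorphism classes are exactly these matchings.)  The chords are the
   pairs (a, f a) with a < f a. *)
Definition diagram (n : nat) := {ffun 'I_(2 * n) -> 'I_(2 * n)}.

Definition is_matching n (f : diagram n) : bool :=
  [forall x, (f x != x) && (f (f x) == x)].

Definition opener n (f : diagram n) (a : 'I_(2 * n)) : bool := a < f a.

Definition crosses n (f : diagram n) (a c : 'I_(2 * n)) : bool :=
  [&& opener f a, opener f c & (a < c < f a) && (f a < f c)].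

Definition cross_rel n (f : diagram n) : rel 'I_(2 * n) :=
  fun a c => crosses f a c || crosses f c a.

Definition cr n (f : diagram n) : nat :=
  #|[set p : 'I_(2 * n) * 'I_(2 * n) | crosses f p.1 p.2]|.

Definition below n (f : diagram n) (a c : 'I_(2 * n)) : bool :=
  [&& opener f a, opener f c & (c < a) && (f a < f c)].

Definition top n (f : diagram n) : nat :=
  #|[set a | opener f a & [forall c, ~~ below f a c]]|.

Definition connected_diag n (f : diagram n) : bool :=
  [forall a, forall c, (opener f a && opener f c) ==> connect (cross_rel f) a c].

(* decomposable: side-by-side concatenation of two nonempty diagrams, i.e.
   there is a cut point 0 < k < 2n that no chord straddles *)
Definition decomposable n (f : diagram n) : bool :=
  [exists k : 'I_(2 * n), (0 < k) && [forall a : 'I_(2 * n), (a < k) == (f a < k)]].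

Definition indecomposable n (f : diagram n) : bool := ~~ decomposable f.

(* coefficient of z^n in B(z,u,v): sum over indecomposable diagrams of size n+1 *)
Definition Bcoef (R : comNzRingType) (n : nat) (u v : R) : R :=
  \sum_(f : diagram n.+1 | is_matching f && indecomposable f)
     (u ^+ top f * v ^+ cr f)%R.

(* coefficient of z^n in C(z,u,v): sum over connected diagrams of size n+1 *)
Definition Ccoef (R : comNzRingType) (n : nat) (u v : R) : R :=
  \sum_(f : diagram n.+1 | is_matching f && connected_diag f)
     (u ^+ top f * v ^+ cr f)%R.

(* Main.v *)
Require Import Defs.
From mathcomp Require Import all_boot all_order all_algebra.
From mathcomp Require Import ring zify.
Import GRing.Theory.
Set Implicit Arguments. Unset Strict Implicit. Unset Printing Implicit Defensive.
Local Open Scope ring_scope.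

(* Read a diagram from left to right and keep the stack of open chords, latest
   opener on top.  Closing the chord at depth r of the stack creates r crossings
   with chords to be closed later, and the chord is a top chord exactly when it
   lies at the bottom.  So a diagram of size n is a weighted lattice path, where
   a closing step has weight v^r, times u at the bottom of the stack, and it is
   indecomposable when the stack stays nonempty in between.

   For connected diagrams, group the open chords into blocks, namely the
   components of the crossing graph seen so far; these are intervals of the
   stack.  Opening a chord starts a new block, closing one merges its block with
   all the blocks above it, and the diagram is connected when no block is used
   up before the last step.  This is detected by intervals of positions that
   are mapped to themselves by the matching.

   Both identities now say that such a path is cut at its first return to a
   one-element stack.  Before that time, ignore the bottom chord: closing the
   lowest of the remaining chords, or closing the bottom one in its place, gives
   the weight 1 + u v.  For blocks, the paths that never close the bottom chord
   use up a block, and C(z,1,v) counts them. *)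

(* A stack lists, latest opener first, whether the open chord is the lowest of
   its block.  After closing depth [r > 0], the chord just above the closed one
   inherits its mark, and the other chords above it are merged into its block. *)
Definition close (r : nat) (s : seq bool) : seq bool :=
  if r is r'.+1 then nseq r' false ++ drop r s else behead s.

(* Closing the only chord of a block would leave a finished component. *)
Definition may_close (r : nat) (s : seq bool) : bool := (0 < r)%N || ~~ head false s.

(* [c] records whether a newly opened chord starts a block: with [c = false]
   no closing step is forbidden, with [c = true] only connected diagrams remain. *)
Fixpoint completions (R : comNzRingType) (c : bool) (v u : R) (m : nat)
    (s : seq bool) {struct m} : R :=
  if m is m'.+1 then
    if s is [::] then 0 else
      @completions R c v u m' (c :: s) +
      \sum_(r < size s) v ^+ r * (if r.+1 == size s then u else 1) *
        (may_close r s)%:R * @completions R c v u m' (close r s)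
  else (s == [::])%:R.

Arguments completions : simpl never.

(** * Weighted stack paths and their first-return recursion *)

Section Recursion.
Variables (R : comNzRingType) (c : bool) (v : R).
Implicit Types (u : R) (m : nat) (s t : seq bool).
Local Notation W := (completions c v).

Lemma completionsS u m s : s != [::] ->
  W u m.+1 s = W u m (c :: s) +
      \sum_(r < size s) v ^+ r * (if r.+1 == size s then u else 1) *
        (may_close r s)%:R * W u m (close r s).
Proof. by case: s. Qed.

Lemma completions0_rcons u s b : W u 0 (rcons s b) = 0.
Proof. by case: s. Qed.

Lemma completions_nil u m : W u m [::] = (m == 0%N)%:R.
Proof. by case: m. Qed.

Lemma size_close r s : (r < size s)%N -> size (close r s) = (size s).-1.
Proof.
by case: r => [|r] lt_r; rewrite /= ?size_behead // size_cat size_nseq size_drop; lia.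
Qed.

Lemma completions_parity u m s : odd (m + size s) -> W u m s = 0.
Proof.
elim: m s => [|m IH] [|b s] //=.
move=> od; rewrite completionsS // IH ?add0r //=; last by move: od => /=; lia.
rewrite big1 // => r _; rewrite IH ?mulr0 // size_close //=.
by move: od => /=; lia.
Qed.

Lemma close_rcons r s b : (r < size s)%N -> close r (rcons s b) = rcons (close r s) b.
Proof.
by case: r s => [|r] [|x s] //= lt_r; rewrite drop_rcons ?rcons_cat // ltnW.
Qed.

Lemma may_close_rcons r s b : (r < size s)%N -> may_close r (rcons s b) = may_close r s.
Proof. by case: s. Qed.

Lemma completions_rcons u m s b :
  W u m.+1 (rcons s b) = W u m (rcons (c :: s) b) +
    \sum_(r < size s) v ^+ r * (may_close r s)%:R * W u m (rcons (close r s) b) +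
    v ^+ size s * u * (may_close (size s) (rcons s b))%:R *
      W u m (close (size s) (rcons s b)).
Proof.
rewrite completionsS; last by rewrite -size_eq0 size_rcons.
rewrite size_rcons big_ord_recr /= eqxx addrA; congr (_ + _ + _).
apply: eq_bigr => r _; rewrite may_close_rcons // close_rcons // eqSS.
by rewrite ltn_eqF ?mulr1.
Qed.

Lemma close_bottom_rcons s b :
  close (size s) (rcons s b) =
    if size s is r.+1 then rcons (nseq r false) b else [::].
Proof.
case: s => [|x s] //=.
by rewrite -cats1 drop_size_cat // cats1.
Qed.

Arguments close : simpl never.

Section FirstReturn.
Variable u : R.
Local Notation X m := (W u m [:: false]).

Let conv (A : nat -> R) m := \sum_(i < m.+1) A i * X (m - i).

Let eq_conv A B m : A =1 B -> conv A m = conv B m.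
Proof. by move=> eqAB; apply: eq_bigr => i _; rewrite eqAB. Qed.

Let convD A B m : conv (fun i => A i + B i) m = conv A m + conv B m.
Proof. by rewrite /conv -big_split /=; apply: eq_bigr => i _; rewrite mulrDl. Qed.

Let convZ a A m : conv (fun i => a * A i) m = a * conv A m.
Proof. by rewrite /conv big_distrr /=; apply: eq_bigr => i _; rewrite mulrA. Qed.

Let conv_sum k (A : 'I_k -> nat -> R) m :
  conv (fun i => \sum_j A j i) m = \sum_j conv (A j) m.
Proof.
rewrite /conv exchange_big; apply: eq_bigr => i _ /=.
by rewrite big_distrl.
Qed.

Let convS A m : A 0%N = 0 -> conv A m.+1 = conv (fun i => A i.+1) m.
Proof. by move=> A0; rewrite /conv big_ord_recl A0 mul0r add0r. Qed.

Let conv_delta m : conv (fun i => (i == 0%N)%:R) m = X m.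
Proof.
rewrite /conv big_ord_recl mul1r subn0 big1 ?addr0 // => i _.
by rewrite mul0r.
Qed.

(* A stack [rcons (rcons t b) false] is run until only its bottom element is
   left.  Forgetting the bottom element turns the run into one from
   [rcons t false], in which closing the lowest chord stands either for closing
   that chord (weight 1) or for closing the bottom one (weight [u * v]).  If
   [b], the runs in which the bottom element is never closed are illegal. *)
Lemma completions_first_return m t b : (b ==> c) ->
  W u m (rcons (rcons t b) false) =
    conv (fun i => W (1 + u * v) i (rcons t false)
                   - b%:R * W 1 i (rcons t false)) m.
Proof.
elim: m t b => [|m IH] t b bc.
  by rewrite /conv big_ord1 !completions0_rcons !(mulr0, subr0, mul0r).
rewrite convS; last first.
  by rewrite !completions0_rcons mulr0 subr0.
pose D s i := W (1 + u * v) i s - b%:R * W 1 i s.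
pose t1 := close (size t) (rcons t false).
have Ht1 : may_close (size t) (rcons t false) by case: (t).
rewrite completions_rcons size_rcons big_ord_recr /=.
(* Closing the lowest chord of [rcons t false] costs [1 + u * v] in the first path and 1 in the
   second. The difference splits into [D t1], for closing that chord itself, and a term [u * v], for
   closing the bottom chord in its place. *)
rewrite [RHS](_ : _ = conv (fun i =>
  D (rcons (c :: t) false) i +
  \sum_(r < size t) (v ^+ r * (may_close r t)%:R * D (rcons (close r t) false) i) +
  v ^+ size t * (D t1 i + u * v * W (1 + u * v) i t1)) m); last first.
  apply: eq_conv => i; rewrite !completions_rcons -/t1 Ht1 /D.
  under [Y in _ = _ + Y + _]eq_bigr do rewrite mulrBr.
  rewrite sumrB.
  under [Y in _ = _ + (_ - Y) + _]eq_bigr do rewrite mulrCA.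
  rewrite -big_distrr /=; ring.
have convE s : D s =1 (fun i => W (1 + u * v) i s - b%:R * W 1 i s) by [].
rewrite 2!convD conv_sum convZ convD convZ (eq_conv _ (convE _)) -IH //.
rewrite -!addrA; congr (_ + _); congr (_ + _).
  apply: eq_bigr => r _; rewrite convZ (eq_conv _ (convE _)) -IH //.
  by rewrite may_close_rcons // close_rcons.
have := close_bottom_rcons (rcons t b) false; rewrite size_rcons => ->.
rewrite (eq_conv _ (convE _)) /t1.
(* For empty [t] either closing reaches the one-element stack at once; closing the upper chord is
   forbidden exactly when [b], whence the factor [1 - b%:R]. *)
case: t => [|x t] in t1 Ht1 *.
  rewrite /= !(eq_conv _ (completions_nil _)) conv_delta.
  rewrite (@eq_conv _ (fun i => (1 - b%:R) * (i == 0%N)%:R)); last first.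
    by move=> i; rewrite !completions_nil; ring.
  rewrite convZ conv_delta; case: (b); rewrite /may_close /=; ring.
rewrite !close_bottom_rcons /= -IH //.
(* Closing the bottom chord merges all blocks above it, so the run goes on with mark [false]: the
   induction hypothesis for [b = false] has no subtracted term. *)
rewrite (_ : conv _ m =
  W u m (rcons (rcons (nseq (size t) false) false) false)); last first.
  by rewrite IH //; apply: eq_conv => i; rewrite mul0r subr0.
have E k : rcons (nseq k false) false = nseq k.+1 false by elim: k => //= k ->.
rewrite !E.
rewrite -[false :: nseq _ _]/(nseq (size t).+2 false) /may_close (exprS _ (size t).+1); ring.
Qed.

(** The first step either closes the only chord, which ends the path and gives [u] for [n = 0], or
    opens a second chord; from there the first-return decomposition applies with [t] empty and
    [b = c]. *)
Lemma completions_recursion n :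
  X n.*2.+1 = (if n == 0%N then u else 0) +
    \sum_(i < n) (W (1 + u * v) i.*2.+1 [:: false] -
                  c%:R * W 1 i.*2.+1 [:: false]) * X (n.-1 - i).*2.+1.
Proof.
rewrite (@completions_rcons u n.*2 [::] false) big_ord0 addr0 /= /close /may_close /=.
rewrite expr0 mul1r mulr1 completions_nil double_eq0 addrC; congr (_ + _).
  by case: eqP; rewrite ?mulr1 ?mulr0.
have -> : [:: c; false] = rcons (rcons [::] c) false by [].
case: n => [|n]; first by rewrite big_ord0 completions0_rcons.
rewrite completions_first_return ?implybb // /conv.
(* Each step changes the height by one, so only paths of odd length lead from height one to zero. *)
have even0 w i : W w i.*2 [:: false] = 0.
  by rewrite completions_parity // addn1 /= odd_double.
pose G i := (W (1 + u * v) i [:: false] - c%:R * W 1 i [:: false]) * X (n.+1.*2 - i).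
rewrite -(big_mkord xpredT G) big_nat_recr //= {2}/G.
rewrite !even0 mulr0 subr0 mul0r addr0.
have pair m (F : nat -> R) : \sum_(0 <= i < m.*2) F i = \sum_(i < m) (F i.*2 + F i.*2.+1).
  elim: m => [|m IHm]; first by rewrite big_geq // big_ord0.
  by rewrite doubleS !big_nat_recr //= IHm big_ord_recr /= addrA.
rewrite pair; apply: eq_bigr => i _; rewrite /G.
rewrite !even0 mulr0 subr0 mul0r add0r.
by congr (_ * X _); have := ltn_ord i; lia.
Qed.
End FirstReturn.
End Recursion.

(** * Partial matchings and the marked stack of open chords *)

Section Prefixes.
Variables (n : nat) (c : bool).
Local Notation I := ('I_(2 * n)).
Implicit Types (f g : diagram n) (k : nat) (x a q i j p : I).
Local Open Scope nat_scope.

(* The unmatched positions of a partial matching are its fixed points. *)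
Definition prefix_of k f : diagram n :=
  [ffun i : I => if (i < k) && (f i < k) then f i else i].

Definition partial_matching k g : Prop :=
  involutive g /\ (forall x, k <= x -> g x = x).

Definition opens k g : seq I :=
  [seq i : I <- rev (enum I) | (i < k) && (g i == i)].

(* The witness [i] is a cut between [q] and the next lower open chord, such that
   no chord read so far straddles [i]. *)
Definition block_start k g q : bool :=
  c && [exists i : I, [&& 0 < i <= q,
          [forall p : I, (p < q) && (g p == p) ==> (p < i)] &
          [forall j : I, (i <= j < k) ==> (i <= g j)]]].

Definition stack k g : seq bool := map (block_start k g) (opens k g).

Definition link g x a : diagram n :=
  [ffun i : I => if i == a then x else if i == x then a else g i].

Let gtI : rel I := fun i j => j < i.

Let gtI_trans : transitive gtI.
Proof. by move=> y x z; rewrite /gtI => yx zy; apply: ltn_trans yx. Qed.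

Lemma mem_opens k g i : (i \in opens k g) = (i < k) && (g i == i).
Proof. by rewrite mem_filter mem_rev mem_enum andbT. Qed.

Lemma uniq_opens k g : uniq (opens k g).
Proof. by rewrite filter_uniq // rev_uniq enum_uniq. Qed.

Lemma sorted_opens k g : sorted gtI (opens k g).
Proof.
apply: sorted_filter; first exact: gtI_trans.
rewrite rev_sorted -(@sorted_map _ _ val ltn) val_enum_ord.
exact: iota_ltn_sorted.
Qed.

Lemma opens_push x g : g x = x -> opens x.+1 g = x :: opens x g.
Proof.
move=> gx; apply: (irr_sorted_eq gtI_trans); rewrite ?sorted_opens //.
- by move=> i; rewrite /gtI ltnn.
- rewrite /= path_sortedE ?sorted_opens ?andbT; last exact: gtI_trans.
  by apply/allP => i; rewrite mem_opens /gtI => /andP[].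
move=> i; rewrite inE !mem_opens ltnS leq_eqVlt.
by case: (eqVneq i x) => [->|ne]; rewrite ?eqxx ?gx ?eqxx // (negPf (_ : val i != val x)).
Qed.

Lemma opens_link x g a : partial_matching x g -> a \in opens x g ->
  opens x.+1 (link g x a) = [seq i <- opens x g | i != a].
Proof.
rewrite mem_opens => -[_ gge] /andP[ax /eqP ga].
rewrite /opens -filter_predI; apply: eq_filter => i /=; rewrite !ffunE.
have neax : (a == x) = false by apply/eqP => E; move: ax; rewrite E ltnn.
case: (eqVneq i a) => [->|nia] /=; first by rewrite eq_sym neax andbF.
case: (eqVneq i x) => [->|nix] /=; first by rewrite neax andbF ltnn.
by rewrite ltnS leq_eqVlt (negPf (_ : val i != val x)).
Qed.

Lemma block_start_push x g q : partial_matching x g -> q < x ->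
  block_start x.+1 g q = block_start x g q.
Proof.
move=> [_ gge] qx; congr (_ && _); apply: eq_existsb => i.
case: (boolP (0 < i <= q)) => //= /andP[_ iq]; congr (_ && _).
apply: eq_forallb => j; rewrite ltnS [j <= x]leq_eqVlt.
case: (eqVneq (val j) (val x)) => [jx|] //=.
by rewrite gge ?jx //= ltnn andbF andbT implybb.
Qed.

Lemma stack_push x g : 0 < x -> partial_matching x g ->
  stack x.+1 g = c :: stack x g.
Proof.
move=> x0 pg; have [_ gge] := pg.
rewrite /stack opens_push ?gge //=; congr (_ :: _); last first.
  by apply/eq_in_map => q; rewrite mem_opens => /andP[qx _]; apply: block_start_push.
(* The cut witness for a newly opened chord is its own position. *)
rewrite /block_start; case: c => //=; apply/existsP; exists x; rewrite x0 leqnn /=.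
apply/andP; split; first by apply/forallP => p; apply/implyP => /andP[].
apply/forallP => j; apply/implyP; rewrite ltnS -eqn_leq => /eqP xj.
by rewrite gge xj.
Qed.

Section Link.
Variables (x a : I) (g : diagram n).
Hypotheses (pg : partial_matching x g) (ax : a < x) (ga : g a = a).

Let linkE i : i != a -> i != x -> link g x a i = g i.
Proof. by move=> /negPf na /negPf nx; rewrite ffunE na nx. Qed.

Let link_open i : i < x -> (link g x a i == i) = (i != a) && (g i == i).
Proof.
move=> ix; have nix : i != x by rewrite -val_eqE /= ltn_eqF.
rewrite ffunE; case: (eqVneq i a) => [->|_]; last by rewrite (negPf nix).
by rewrite -val_eqE /= gtn_eqF.
Qed.

(** The only new chord joins [a] to [x], and it straddles [i] unless [i <= a]. *)
Let cut_link i : i < x ->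
  [forall j : I, (i <= j < x.+1) ==> (i <= link g x a j)] =
  (i <= a) && [forall j : I, (i <= j < x) ==> (i <= g j)].
Proof.
move=> ix; have nax : x != a by rewrite -val_eqE /= gtn_eqF.
apply/forallP/andP => [H|[ia /forallP H] j].
  have ia : i <= a.
    by have := H x; rewrite ltnSn ltnW //= ffunE (negPf nax) eqxx.
  split=> //; apply/forallP => j; apply/implyP => /andP[ij jx].
  case: (eqVneq j a) => [->|nja]; first by rewrite ga.
  have := H j; rewrite ij ltnS ltnW //= linkE //.
  by rewrite -val_eqE /= ltn_eqF.
apply/implyP => /andP[ij]; rewrite ltnS leq_eqVlt ffunE.
case: (eqVneq j a) => [_ _|nja]; first exact: ltnW.
case: (eqVneq j x) => //= njx; rewrite (negPf (_ : val j != val x)) //= => jx.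
by have := H j; rewrite ij jx.
Qed.

Lemma block_start_link_below q : q < a -> block_start x.+1 (link g x a) q = block_start x g q.
Proof.
move=> qa; congr (_ && _); apply: eq_existsb => i.
case: (boolP (0 < i <= q)) => //= /andP[_ iq].
rewrite cut_link; last by lia.
rewrite (_ : i <= a); last by lia.
congr (_ && _); apply: eq_forallb => p; case: (ltnP p q) => //= pq.
rewrite link_open; last by lia.
by rewrite (_ : p != a) // -val_eqE /= ltn_eqF //; lia.
Qed.

(** A cut for [q] would lie above the open chord [p], hence above [a], where the new chord straddles
    it. *)
Lemma block_start_link_above p q : a < p -> p < q -> q < x -> g p = p ->
  block_start x.+1 (link g x a) q = false.
Proof.
move=> ap pq qx gp; apply/negbTE; rewrite /block_start negb_and; apply/orP; right.
apply/existsPn => i; apply/negP => /and3P[/andP[_ iq] /forallP /(_ p)].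
rewrite link_open; last exact: ltn_trans qx.
rewrite gp eqxx pq andbT.
rewrite -val_eqE /= gtn_eqF //= => pi.
rewrite cut_link; last exact: leq_ltn_trans qx.
by rewrite leqNgt (ltn_trans ap pi).
Qed.

(** Once [a] is closed, [q] has the same open chords below it as [a] had, and its cuts must lie at
    or below [a]; so both have the same witnesses. *)
Lemma block_start_link_next q : a < q -> q < x ->
  (forall p, g p = p -> p < q -> p <= a) ->
  block_start x.+1 (link g x a) q = block_start x g a.
Proof.
move=> aq qx nop; congr (_ && _); apply/existsP/existsP => -[i].
  case/and3P=> /andP[i0 iq] /forallP Hp.
  rewrite cut_link; last exact: leq_ltn_trans qx.
  move=> /andP[ia cut].
  exists i; rewrite i0 ia cut /= andbT; apply/forallP => p.
  apply/implyP => /andP[pa gp]; have := Hp p.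
  rewrite (ltn_trans pa aq) link_open; last exact: ltn_trans ax.
  rewrite gp andbT /=.
  by rewrite -val_eqE /= ltn_eqF.
case/and3P=> /andP[i0 ia] /forallP Hp cut.
have iq := leq_trans ia (ltnW aq).
exists i; rewrite cut_link; last exact: leq_ltn_trans qx.
rewrite i0 iq ia cut /= andbT.
apply/forallP => p; apply/implyP => /andP[pq].
rewrite link_open; last exact: ltn_trans qx.
move=> /andP[npa gp].
have := Hp p; rewrite gp andbT ltn_neqAle nop ?(eqP gp) // andbT.
by rewrite val_eqE npa.
Qed.

Lemma stack_link : stack x.+1 (link g x a) = close (index a (opens x g)) (stack x g).
Proof.
have a_op : a \in opens x g by rewrite mem_opens ax ga eqxx.
rewrite /stack opens_link //.
have us := uniq_opens x g; have := sorted_opens x g.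
rewrite (sorted_pairwise gtI_trans).
have mo i : i \in opens x g <-> i < x /\ g i = i.
  by rewrite mem_opens; split=> [/andP[ix /eqP]|[-> ->]] //; rewrite eqxx.
move: us mo; case/splitPr: a_op => l1 l2.
rewrite cat_uniq /= negb_or => /and4P[_ /andP[na1 _] na2 _] mo.
rewrite pairwise_cat /= allrel_consr -!andbA => /and5P[/allP gt1 _ pw1 /allP lt2 _].
rewrite index_cat (negPf na1) /= eqxx addn0 filter_cat /= eqxx !map_cat /=.
have /all_filterP-> : all (fun i => i != a) l1.
  by apply/allP => i il; apply: contraNneq na1 => <-.
have /all_filterP-> : all (fun i => i != a) l2.
  by apply/allP => i il; apply: contraNneq na2 => <-.
have -> : map (block_start x.+1 (link g x a)) l2 = map (block_start x g) l2.
  by apply/eq_in_map => q /lt2; apply: block_start_link_below.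
(* If some chord lies above [a], the lowest one, [q], inherits the mark of [a], and the rest [l1] is
   merged into its block. *)
case/lastP: l1 => [|l1 q] //= in mo gt1 pw1 na1 *.
rewrite size_rcons /close drop_size_cat ?size_map ?size_rcons // map_rcons.
rewrite -cats1 -catA /=.
have lt_x p : p \in rcons l1 q -> p < x /\ g p = p.
  by move=> pl; apply/mo; rewrite mem_cat pl.
have [qx gq] : q < x /\ g q = q by apply: lt_x; rewrite mem_rcons mem_head.
have aq : a < q by apply: gt1; rewrite mem_rcons mem_head.
move: pw1; rewrite -cats1 pairwise_cat allrel1r => /and3P[/allP gtq _ _].
congr (_ ++ _ :: _).
  have /eq_in_map-> : {in l1, block_start x.+1 (link g x a) =1 (fun=> false)}.
    move=> p pl; have [px _] : p < x /\ g p = p.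
      by apply: lt_x; rewrite mem_rcons inE pl orbT.
    by apply: block_start_link_above aq _ px gq; apply: gtq.
  by elim: l1 {mo gt1 na1 lt_x gtq} => //= y l1 ->.
apply: block_start_link_next => // p gp pq.
have : p \in rcons l1 q ++ a :: l2 by apply/mo; split=> //; apply: ltn_trans qx.
rewrite mem_cat mem_rcons !inE -orbA => /or4P[/eqP E|/gtq|/eqP->|/lt2] //.
- by move: pq; rewrite E ltnn.
- by rewrite /gtI ltnNge (ltnW pq).
exact: ltnW.
Qed.
End Link.
End Prefixes.

(** * Summing over the matchings that extend a given prefix *)

Section Scan.
Variables (R : comNzRingType) (n : nat) (c : bool) (u v : R).
Local Notation I := ('I_(2 * n)).
Implicit Types (f g : diagram n) (k : nat) (x a q i j p : I).

Lemma matchingP f : reflect ((forall x, f x != x) /\ involutive f) (is_matching f).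
Proof.
apply: (iffP forallP) => [H|[H1 H2] x]; last by rewrite H1 H2 eqxx.
by split=> x; have /andP[? /eqP] := H x.
Qed.

Lemma leq_ord_neq x i : i != x -> (i <= x)%N = (i < x)%N.
Proof. by move=> nix; rewrite ltn_neqAle val_eqE nix. Qed.

Lemma prefix_push f g x : is_matching f -> partial_matching x g ->
  (prefix_of x f == g) && (x < f x)%N = (prefix_of x.+1 f == g).
Proof.
case/matchingP=> nf ff [_ gge].
have E : (x < f x)%N -> prefix_of x.+1 f = prefix_of x f.
  move=> xf; apply/ffunP => i; rewrite !ffunE !ltnS.
  case: (eqVneq i x) => [->|nix]; first by rewrite ltnn (leqNgt (f x)) xf andbF.
  case: (eqVneq (f i) x) => [fi|nfi].
    have -> : i = f x by rewrite -fi ff.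
    by rewrite ff ltnn andbF (leqNgt (f x)) xf.
  by rewrite !leq_ord_neq.
apply/andP/eqP => [[/eqP <-] /E //|gE].
suff xf : (x < f x)%N by rewrite -gE E.
rewrite ltnNge; apply/negP => fx; have := gge x (leqnn x).
by rewrite -gE ffunE ltnS leqnn ltnS fx /=; apply/eqP.
Qed.

Lemma prefix_link f g x a : is_matching f -> partial_matching x g -> a \in opens x g ->
  (prefix_of x f == g) && (f x == a) = (prefix_of x.+1 f == link g x a).
Proof.
rewrite mem_opens => /matchingP[nf ff] [_ gge] /andP[ax /eqP ga].
have nxa : (x == a) = false by rewrite -val_eqE /= gtn_eqF.
have E : f x = a -> prefix_of x.+1 f = link (prefix_of x f) x a.
  move=> fx; apply/ffunP => i; rewrite !ffunE !ltnS.
  case: (eqVneq i a) => [->|nia]; first by rewrite -{2 3}fx ff leqnn ltnW.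
  case: (eqVneq i x) => [->|nix]; first by rewrite fx leqnn ltnW.
  have nfi : f i != x by apply: contraNneq nia => fi; rewrite -fx -fi ff.
  by rewrite !leq_ord_neq.
apply/andP/eqP => [[/eqP <- /eqP] /E //|gE].
have fx : f x = a.
  have /ffunP/(_ x) := gE; rewrite !ffunE nxa eqxx ltnS leqnn /=.
  by case: ifP => // _ xa; move: nxa; rewrite xa eqxx.
rewrite fx eqxx; split=> //; apply/eqP/ffunP => i.
move: gE; rewrite E // => /ffunP/(_ i); rewrite [LHS]ffunE [RHS]ffunE.
case: (eqVneq i a) => [-> _|nia].
  by rewrite ffunE -[in f a]fx ff ltnn andbF ga.
case: (eqVneq i x) => [-> _|//].
by rewrite ffunE ltnn gge.
Qed.

Lemma partial_push g x : partial_matching x g -> partial_matching x.+1 g.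
Proof. by case=> gg gge; split=> // i xi; apply/gge/ltnW. Qed.

Lemma partial_link g x a : partial_matching x g -> a \in opens x g ->
  partial_matching x.+1 (link g x a).
Proof.
rewrite mem_opens => -[gg gge] /andP[ax /eqP ga].
have nxa : (x == a) = false by rewrite -val_eqE /= gtn_eqF.
split=> i; rewrite !ffunE; last first.
  move=> xi; rewrite (gge _ (ltnW xi)) -(val_eqE i a) -(val_eqE i x) /= !gtn_eqF //.
  exact: ltn_trans xi.
case: (eqVneq i a) => [->|nia]; first by rewrite nxa eqxx.
case: (eqVneq i x) => [->|nix]; first by rewrite eqxx.
have /negPf-> : g i != a by apply: contraNneq nia => E; rewrite -(gg i) E ga.
have /negPf-> : g i != x by apply: contraNneq nix => E; rewrite -(gg i) E gge.
exact: gg.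
Qed.

Definition step_weight g x a : R :=
  let r := index a (opens x g) in
  v ^+ r * (if r.+1 == size (opens x g) then u else 1) * (may_close r (stack c x g))%:R.

Definition position_weight f x : R :=
  (opens x (prefix_of x f) != [::])%:R *
  (if (f x < x)%N then step_weight (prefix_of x f) x (f x) else 1).

(** Induction on the number of unread positions: the matchings extending [g] are split by whether
    the next position opens a chord or which open chord it closes. *)
Lemma sum_prefix_completions k g : (0 < k <= 2 * n)%N -> partial_matching k g ->
  \sum_(f : diagram n | is_matching f && (prefix_of k f == g))
     \prod_(x : I | (k <= x)%N) position_weight f x =
  completions c v u (2 * n - k) (stack c k g).
Proof.
move: {2}(2 * n - k)%N (erefl (2 * n - k)%N) => m.
elim: m k g => [|m IH] k g Em /andP[k0 kN] pg; have [gg gge] := pg.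
  have {Em kN}Ek : k = (2 * n)%N by lia.
  subst k; rewrite subnn /completions.
  have preE f : prefix_of (2 * n) f = f.
    by apply/ffunP => i; rewrite ffunE !ltn_ord.
  rewrite (eq_bigr (fun=> 1)); last first.
    by move=> f _; apply: big1 => x; rewrite leqNgt ltn_ord.
  rewrite /stack; case: (boolP (is_matching g)) => mg.
    rewrite (big_pred1 g).
      case/matchingP: mg => nf _; rewrite (_ : opens _ g = [::]) //.
      apply/eqP; rewrite -size_eq0 -leqn0 leqNgt -has_predT; apply/hasPn => i.
      by rewrite mem_opens (negPf (nf i)) andbF.
    by move=> f; rewrite preE /=; case: (eqVneq f g) => [->|_]; rewrite ?mg ?andbF.
  rewrite big1 => [|f /andP[mf]]; last by rewrite preE => /eqP E; rewrite -E mf in mg.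
  move: mg => /forallPn[i]; rewrite gg eqxx andbT negbK => gi.
  have : i \in opens (2 * n) g by rewrite mem_opens ltn_ord.
  by case: (opens _ g).
have kN' : (k < 2 * n)%N by lia.
have [x Ex] : exists x : I, x = k :> nat by exists (Ordinal kN').
subst k.
have prodE f : \prod_(y : I | (x <= y)%N) position_weight f y =
    position_weight f x * \prod_(y : I | (x.+1 <= y)%N) position_weight f y.
  rewrite (bigD1 x) //=; congr (_ * _); apply: eq_bigl => y.
  by rewrite ltn_neqAle andbC eq_sym.
under eq_bigr do rewrite prodE.
rewrite Em; case: (eqVneq (opens x g) [::]) => [o0|o0].
  rewrite /stack o0 completions_nil big1 // => f /andP[_ /eqP E].
  by rewrite /position_weight E o0 eqxx !mul0r.
rewrite completionsS; last by rewrite /stack; case: (opens x g) o0.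
have Em' : (2 * n - x.+1)%N = m by lia.
have xN : (0 < x.+1 <= 2 * n)%N by rewrite ltn_ord.
rewrite (bigID (fun f => x < f x)%N) /=; congr (_ + _).
  rewrite -stack_push // -Em' -IH //; last exact: partial_push.
  rewrite (eq_bigl (fun f => is_matching f && (prefix_of x.+1 f == g))); last first.
    by move=> f; case mf: (is_matching f) => //=; apply: prefix_push.
  apply: eq_bigr => f /andP[mf]; rewrite -prefix_push // => /andP[/eqP E xf].
  by rewrite /position_weight E o0 ltnNge ltnW ?mul1r.
have fx_open f : [&& is_matching f, prefix_of x f == g & ~~ (x < f x)%N] ->
    f x \in opens x g.
  case/and3P=> /matchingP[nf ff] /eqP <-.
  rewrite -leqNgt leq_eqVlt val_eqE (negPf (nf x)) /=.
  by move=> fx; rewrite mem_opens fx ffunE fx ff ltnn eqxx.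
rewrite (partition_big (fun f => f x) (mem (opens x g))) /=; last first.
  by move=> f; rewrite -andbA; apply: fx_open.
(* The sum over partners of [x] becomes a sum over depths in the stack. *)
rewrite -big_uniq ?uniq_opens //= (big_nth x) big_mkord size_map.
apply: eq_bigr => r _; set a := nth x (opens x g) r.
have ao : a \in opens x g by apply: mem_nth.
have := ao; rewrite mem_opens => /andP[ax /eqP ga].
have ia : index a (opens x g) = r by apply: index_uniq => //; apply: uniq_opens.
have -> : close r (stack c x g) = stack c x.+1 (link g x a) by rewrite stack_link ?ia.
rewrite -Em' -IH //; last exact: partial_link.
rewrite big_distrr /=.
rewrite (eq_bigl (fun f => is_matching f && (prefix_of x.+1 f == link g x a))); last first.
  move=> f; case mf: (is_matching f) => //=; rewrite -prefix_link // -andbA.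
  case: (prefix_of x f == g) => //=.
  by case: eqP => [->|]; rewrite ?andbF // -leqNgt ltnW.
apply: eq_bigr => f /andP[mf]; rewrite -prefix_link // => /andP[/eqP E /eqP fx].
by rewrite /position_weight E o0 fx ax mul1r /step_weight ia.
Qed.

End Scan.

(** * Crossings, top chords, indecomposability and connectedness read off the scan *)

Section Statistics.
Variable n : nat.
Local Notation I := ('I_(2 * n)).
Implicit Types (f g : diagram n) (k : nat) (x a q i j p y : I) (s : seq I).
Local Open Scope nat_scope.

Lemma index_gt_sorted s a : sorted (fun i j : I => j < i) s -> a \in s ->
  index a s = count (fun i : I => a < i) s /\
  ((index a s).+1 == size s) = ~~ has (fun i : I => i < a) s.
Proof.
elim: s => [|y s IH] //= ys; rewrite inE.
have /allP lty : all (fun i : I => i < y) s.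
  by apply: order_path_min ys => p q i pq ip; apply: ltn_trans pq.
case: (eqVneq a y) => [-> _|nay /= as_].
  rewrite ltnn /= eqSS; split.
    apply/esym/eqP; rewrite add0n -leqn0 leqNgt -has_count; apply/hasPn => i /lty.
    by rewrite -leqNgt => /ltnW.
  case: s {IH ys} lty => [|z s] //= -> //; exact: mem_head.
have [IH1 IH2] := IH (path_sorted ys) as_.
have lt_ay := lty _ as_; rewrite lt_ay eqSS IH2 IH1; split=> //.
by rewrite (ltnNge y) ltnW.
Qed.

Section Matching.
Variable f : diagram n.
Hypothesis mf : is_matching f.

Let nf x : (f x == x) = false.
Proof. by case/matchingP: mf => nf _; apply/negbTE/nf. Qed.

Let ff : involutive f.
Proof. by case/matchingP: mf. Qed.

Lemma mem_opens_prefix x i :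
  (i \in opens x (prefix_of x f)) = (i < x) && (x <= f i).
Proof.
rewrite mem_opens ffunE; case: (ltnP i x) => //= ix.
by case: ltnP => _; rewrite ?nf ?eqxx.
Qed.

Lemma closer_mem_opens x : f x < x -> f x \in opens x (prefix_of x f).
Proof. by move=> fx; rewrite mem_opens_prefix fx ff leqnn. Qed.

Lemma opens_prefix_nil x :
  (opens x (prefix_of x f) == [::]) = [forall a : I, (a < x) == (f a < x)].
Proof.
apply/eqP/forallP => [E a|H].
  have lt i : i < x -> f i < x.
    move=> ix; rewrite ltnNge; apply/negP => xf.
    by have := mem_opens_prefix x i; rewrite E ix xf.
  by apply/eqP; apply/idP/idP => /lt //; rewrite ff.
apply/eqP; rewrite -size_eq0 -leqn0 leqNgt -has_predT; apply/hasPn => i.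
rewrite mem_opens_prefix => /andP[ix]; rewrite leqNgt.
by rewrite -(eqP (H i)) ix.
Qed.

(** The entries above [f x] in the stack opened later and are still open at [x], so these are the
    chords crossing it on the right. *)
Lemma index_closer x : f x < x ->
  index (f x) (opens x (prefix_of x f)) = #|[set a | crosses f (f x) a]|.
Proof.
move=> fx; have /index_gt_sorted[|-> _] := closer_mem_opens fx.
  exact: sorted_opens.
rewrite -size_filter -(card_uniqP (filter_uniq _ (uniq_opens _ _))).
apply: eq_card => a; rewrite !inE mem_filter mem_opens_prefix /crosses /opener ff fx.
apply/andP/and3P => [[fa /andP[ax xf]]|[_ oa /andP[/andP[fa ax] xf]]].
  have : f a != x by apply: contraTneq fa => <-; rewrite ff ltnn.
  rewrite -val_eqE eq_sym => ne; have xfa : x < f a by rewrite ltn_neqAle ne.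
  by rewrite fa ax xfa (ltn_trans ax xfa).
by rewrite fa ax ltnW.
Qed.

(** An entry deeper in the stack opened earlier and closes later, so it covers the chord being
    closed. *)
Lemma index_closer_bottom x : f x < x ->
  ((index (f x) (opens x (prefix_of x f))).+1 == size (opens x (prefix_of x f))) =
  [forall a, ~~ below f (f x) a].
Proof.
move=> fx; have /index_gt_sorted[|_ ->] := closer_mem_opens fx.
  exact: sorted_opens.
apply/hasPn/forallP => H a.
  apply/negP; rewrite /below /opener ff fx => /and3P[_ oa /andP[af xf]].
  have := H a; rewrite mem_opens_prefix (ltn_trans af fx) ltnW // af.
  by move/(_ isT).
rewrite mem_opens_prefix => /andP[ax xf]; apply/negP => af.
have := H a; rewrite /below /opener ff fx af /=; case/negP.
have : f a != x by apply: contraTneq af => <-; rewrite ff ltnn.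
rewrite -val_eqE eq_sym => ne; have xfa : x < f a by rewrite ltn_neqAle ne.
by rewrite xfa (ltn_trans ax xfa).
Qed.

Lemma may_close_index c k g a : a \in opens k g ->
  may_close (index a (opens k g)) (stack c k g) =
  ~~ ((index a (opens k g) == 0) && block_start c k g a).
Proof.
rewrite /may_close /stack; case: (opens k g) => //= y s.
by case: (eqVneq y a) => [->|].
Qed.

(** The conjunction of the 0/1 factors in the product of [position_weight] over positive
    positions. *)
Definition admissible c : bool :=
  [forall x : I, (0 < x) ==> (opens x (prefix_of x f) != [::])] &&
  [forall x, (f x < x) ==>
     may_close (index (f x) (opens x (prefix_of x f))) (stack c x (prefix_of x f))].

Lemma admissible_indecomposable : admissible false = indecomposable f.
Proof.
rewrite /admissible andbC (_ : [forall x, _]); last first.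
  apply/forallP => x; apply/implyP => fx.
  by rewrite may_close_index ?closer_mem_opens // /block_start andbF.
rewrite /indecomposable /decomposable negb_exists; apply: eq_forallb => x.
by rewrite opens_prefix_nil negb_and -implybE.
Qed.

Definition closed_interval i j := forall x, i <= x <= j -> i <= f x <= j.

(** In a closed interval from [i] to [j], the chord closed at [j] is the latest one still open and
    [i] is a cut below it, so this closing is forbidden. Conversely, a forbidden closing at [x] with
    cut [i] closes the interval from [i] to [x], and an empty stack at [x] closes the one from [x]
    to the last position. *)
Lemma admissible_no_closed_interval :
  reflect (forall i j, 0 < i <= j -> ~ closed_interval i j) (admissible true).
Proof.
apply: (iffP andP) => [[_ /forallP gd] i j /andP[i0 ij] cl|H].
  have /andP[ifj fjj] : i <= f j <= j by apply: cl; rewrite ij leqnn.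
  have fj : f j < j by rewrite -leq_ord_neq // nf.
  have := gd j; rewrite fj may_close_index ?closer_mem_opens //=; case/negP.
  have no y : y < j -> j <= f y -> i <= y -> y = f j.
    move=> yj jf iy; have /andP[_ fyj] : i <= f y <= j by apply: cl; rewrite iy ltnW.
    apply: (inv_inj ff); rewrite ff; apply/val_inj/anti_leq.
    by rewrite fyj.
  apply/andP; split.
    have /index_gt_sorted[|-> _] := closer_mem_opens fj; first exact: sorted_opens.
    rewrite -leqn0 leqNgt -has_count; apply/hasPn => y.
    rewrite mem_opens_prefix => /andP[yj jf]; apply/negP => fjy.
    by move: (fjy); rewrite (no y yj jf) ?ltnn // (leq_trans ifj) // ltnW.
  apply/existsP; exists i; rewrite i0 ifj /=; apply/andP; split.
    apply/forallP => p; apply/implyP => /andP[pf op].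
    have : p \in opens j (prefix_of j f) by rewrite mem_opens op (ltn_trans pf).
    rewrite mem_opens_prefix => /andP[pj jf]; rewrite ltnNge; apply/negP => ip.
    by move: pf; rewrite (no p pj jf ip) ltnn.
  apply/forallP => y; apply/implyP => /andP[iy yj]; rewrite ffunE.
  by case: ifP => // _; have /andP[] : i <= f y <= j by apply: cl; rewrite iy ltnW.
split; apply/forallP => x; apply/implyP.
  move=> x0; rewrite opens_prefix_nil; apply/negP => /forallP eqx.
  have lt_last : (2 * n).-1 < 2 * n by have := ltn_ord x; lia.
  apply: (H x (Ordinal lt_last)) => [|y /andP[xy _]] /=.
    by have := ltn_ord x; lia.
  have := eqP (eqx y); have := ltn_ord (f y); lia.
move=> fx; rewrite may_close_index ?closer_mem_opens //; apply/negP => /andP[/eqP i0].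
case/existsP=> i /and3P[/andP[igt0 ifx] /forallP Hp /forallP cut].
have above y : y \in opens x (prefix_of x f) -> y <= f x.
  move=> yo; rewrite leqNgt; apply/negP => fy.
  have /index_gt_sorted[|E _] := closer_mem_opens fx; first exact: sorted_opens.
  have : has (fun i : I => f x < i) (opens x (prefix_of x f)) by apply/hasP; exists y.
  by rewrite has_count -E i0.
apply: (H i x); first by rewrite igt0 (leq_trans ifx) // ltnW.
move=> y /andP[iy]; rewrite leq_eqVlt => /orP[/eqP/val_inj->|yx].
  by rewrite ifx ltnW.
have := cut y; rewrite iy yx ffunE yx /=.
case: (ltnP (f y) x) => [fyx -> |xfy _]; first exact: ltnW.
case: (eqVneq y (f x)) => [->|ny].
  by rewrite ff leqnn (leq_trans ifx) // ltnW.
have yo : y \in opens x (prefix_of x f) by rewrite mem_opens_prefix yx.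
have yfx : y < f x by rewrite ltn_neqAle val_eqE ny above.
have := Hp y; rewrite yfx; move: yo; rewrite mem_opens => /andP[_ ->] /=.
by rewrite ltnNge iy.
Qed.

Let cross_sym : connect_sym (cross_rel f).
Proof. by apply: sym_connect_sym => a b; rewrite /cross_rel orbC. Qed.

(** Chords inside a closed interval cross none outside, and the chord at 0 is outside. Conversely, a
    component avoiding the chord at 0 spans a closed interval, from its first opener to its last
    closer. *)
Lemma connected_no_closed_interval :
  reflect (forall i j, 0 < i <= j -> ~ closed_interval i j) (connected_diag f).
Proof.
apply: (iffP forallP) => [con i j /andP[i0 ij] cl|H].
  have N0 : 0 < 2 * n by apply: leq_trans (ltn_ord i).
  pose z : I := Ordinal N0.
  have oz : opener f z by have := nf z; rewrite -val_eqE /opener lt0n /= => ->.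
  have oi : opener f i.
    have /andP[ifi _] : i <= f i <= j by apply: cl; rewrite leqnn.
    by rewrite /opener ltn_neqAle ifi andbT eq_sym val_eqE nf.
  have /forallP/(_ z) := con i; rewrite oi oz /=.
  have clo : closed (cross_rel f) [pred y : I | i <= y <= j].
    apply: intro_closed => [|a b]; first exact: cross_sym.
    rewrite !inE => ab aij; have faij := cl a aij; move: ab; rewrite /cross_rel /crosses.
    case/orP=> /and3P[_ _ /andP[/andP[ab bf] fab]]; first by lia.
    have := cl (f b); rewrite ff; lia.
  move/(closed_connect clo); rewrite !inE leqnn ij leqNgt i0 //.
move=> x; apply/forallP => y; apply/implyP => /andP[ox oy].
have N0 : 0 < 2 * n by apply: leq_trans (ltn_ord x).
pose z : I := Ordinal N0.
suff to0 w : opener f w -> connect (cross_rel f) w z.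
  by apply: (connect_trans (to0 _ ox)); rewrite cross_sym; apply: to0.
move=> ow {x y ox oy}; apply/negPn/negP => nc.
pose K := [pred a : I | opener f a & connect (cross_rel f) w a].
have Kw : K w by rewrite /= ow connect0.
have Kstep a b : K a -> cross_rel f a b -> K b.
  move=> /andP[oa wa] ab /=; rewrite (connect_trans wa (connect1 ab)) andbT.
  by case/orP: ab => /and3P[].
case: (arg_minnP (fun a : I => val a) Kw) => i Ki imin.
case: (arg_maxnP (fun a : I => val (f a)) Kw) => m Km mmax.
apply: (H i (f m)).
  rewrite (leq_trans (imin _ Km)) ?andbT; last by case/andP: Km => /ltnW.
  rewrite lt0n; apply/eqP => i0; case/negP: nc.
  by case/andP: Ki => _; rewrite (_ : i = z) //; apply: val_inj.
move=> y /andP[iy ym]; apply/negPn/negP => nfy.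
have bounds a : K a -> i <= a /\ f a <= f m.
  by move=> Ka; split; [apply: imin|apply: mmax].
have lt_op a : K a -> a < f a by case/andP.
have nKy a : K a -> y != a :> nat /\ y != f a :> nat.
  move=> Ka; have [b1 b2] := bounds _ Ka; have lt := lt_op _ Ka.
  by split; apply: contra nfy => /eqP/val_inj->; rewrite ?ff; lia.
(* A chord of [K] straddling [y] would cross the chord of [y], whose other end lies outside the
   span; that chord would then belong to [K] and lie inside. *)
have side a : K a -> (f a < y) || (y < a).
  move=> Ka; have [b1 b2] := bounds _ Ka; have lt := lt_op _ Ka.
  have [n1 n2] := nKy _ Ka.
  apply/negPn/negP => nside.
  have [ay ya] : a < y /\ y < f a by lia.
  have [fyfa|fya] : f a < f y \/ f y < a by lia.
    have : K y.
      apply: (Kstep a) => //; rewrite /cross_rel /crosses /opener lt ay ya fyfa.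
      by rewrite (ltn_trans ya).
    by move/bounds => [[b3 b4]]; case/negP: nfy; lia.
  have : K (f y).
    apply: (Kstep a) => //; rewrite /cross_rel /crosses /opener ff lt ay ya fya.
    by rewrite (ltn_trans fya) ?orbT.
  by move/bounds; rewrite ff => -[b3 b4]; case/negP: nfy; lia.
(* The chords of [K] left of [y] cross none to its right, yet [i] is among them and [m] is not,
   against connectedness of [K]. *)
pose Q := [pred a : I | K a & f a < y].
have Qcl : closed (cross_rel f) Q.
  apply: intro_closed => [|a b ab]; first exact: cross_sym.
  move=> /andP[Ka ay]; have Kb := Kstep _ _ Ka ab; apply/andP; split=> //.
  have /orP[//|yb] := side _ Kb.
  by case/orP: ab => /and3P[_ _]; have := lt_op _ Ka; have := lt_op _ Kb; lia.
have Qi : Q i.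
  apply/andP; split=> //.
  by have [n1 _] := nKy _ Ki; have := side _ Ki; lia.
have im : connect (cross_rel f) i m.
  case/andP: Ki => _ wi; case/andP: Km => _ wm.
  by apply: connect_trans wm; rewrite cross_sym.
have : m \in Q by rewrite -(closed_connect Qcl im).
by move=> /andP[_]; rewrite ltnNge ym.
Qed.

End Matching.

Local Open Scope ring_scope.
Lemma prod_natr_forall (R : comNzRingType) (T : finType) (P b : pred T) :
  \prod_(x | P x) (b x)%:R = [forall x, P x ==> b x]%:R :> R.
Proof.
case: forallP => [H|/forallP/forallPn[x]].
  by apply: big1 => x Px; have := H x; rewrite Px => /= ->.
by rewrite negb_imply => /andP[Px /negPf bx]; rewrite (bigD1 x) //= bx mul0r.
Qed.

(** Each crossing is counted once, at the closer of the chord that opens, and hence closes,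
    first. *)
Lemma prod_position_weight (R : comNzRingType) c (u v : R) f : is_matching f ->
  \prod_(x : I | (1 <= x)%N) position_weight c u v f x =
    (admissible f c)%:R * (u ^+ top f * v ^+ cr f).
Proof.
move=> mf; have [_ ff] := matchingP _ mf.
rewrite big_split /= (prod_natr_forall _ (fun x : I => 0 < x)%N).
rewrite -big_mkcondr /= (eq_bigl (fun x => f x < x)%N); last first.
  by move=> x; apply: andb_idl => fx; apply: leq_ltn_trans fx.
rewrite !big_split /= (prod_natr_forall _ (fun x : I => f x < x)%N).
rewrite /admissible -mulnb natrM -!mulrA; congr (_ * _).
rewrite mulrA [RHS]mulrC; congr (_ * _); rewrite mulrC; congr (_ * _).
  rewrite -big_mkcondr /=.
  pose P a := opener f a && [forall b, ~~ below f a b].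
  rewrite (eq_bigl (fun x => P (f x))); last first.
    move=> x; rewrite /P /opener ff; case: ltnP => //= fx.
    by rewrite index_closer_bottom.
  rewrite -(reindex_inj (inv_inj ff)) prodr_const; congr (_ ^+ _).
  by apply: eq_card => a; rewrite inE.
rewrite prodrXr; congr (_ ^+ _).
rewrite (eq_bigr (fun x => #|[set a | crosses f (f x) a]|)); last first.
  by move=> x; apply: index_closer.
have -> : cr f = (\sum_a #|[set b | crosses f a b]|)%N.
  rewrite /cr -sum1_card (eq_bigl (fun ab => true && crosses f ab.1 ab.2)).
    rewrite -(pair_big_dep xpredT (crosses f) (fun _ _ => 1%N)) /=.
    by apply: eq_bigr => a _; rewrite sum1dep_card.
  by move=> ab; rewrite inE.
rewrite [RHS](bigID (opener f)) /= [X in (_ + X)%N]big1 ?addn0; last first.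
  by move=> a na; apply: eq_card0 => b; rewrite inE /crosses (negPf na).
rewrite [RHS](reindex_inj (inv_inj ff)) /=; apply: eq_bigl => x.
by rewrite /opener ff.
Qed.
End Statistics.

(** * The coefficients as path sums, and the two identities *)

Lemma sum_admissible_completions (R : comNzRingType) (c : bool) (u v : R) (n : nat) :
  \sum_(f : diagram n.+1 | is_matching f && admissible f c) (u ^+ top f * v ^+ cr f) =
  completions c v u n.*2.+1 [:: false].
Proof.
have N0 : (0 < 2 * n.+1)%N by rewrite mulnS.
pose z : 'I_(2 * n.+1) := Ordinal N0.
pose g : diagram n.+1 := [ffun i => i].
have pg : partial_matching 1 g.
  by split=> i; rewrite ?ffunE // => _; rewrite ffunE.
have pE f : is_matching f -> prefix_of 1 f = g.
  case/matchingP=> nf _; apply/ffunP => i; rewrite !ffunE !ltnS !leqn0.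
  case: eqP => //= i0; case: eqP => // fi0.
  by apply/val_inj; rewrite /= fi0 i0.
(* The chord at 0 is unmarked, since a cut must be positive; so the last closing step is allowed. *)
have sE : stack c 1 g = [:: false].
  have gz : g z = z by rewrite ffunE.
  rewrite /stack -[1%N]/(z.+1) opens_push // (_ : opens z g = [::]) /=.
    congr [:: _]; apply/negbTE; rewrite /block_start negb_and; apply/orP; right.
    by apply/existsPn => i; rewrite lt0n leqn0; case: eqP.
  apply/eqP; rewrite -size_eq0 -leqn0 leqNgt -has_predT; apply/hasPn => i.
  by rewrite mem_opens.
have -> : n.*2.+1 = (2 * n.+1 - 1)%N by lia.
rewrite -sE -sum_prefix_completions ?N0 //.
rewrite [RHS](eq_bigl (fun f => is_matching f)) => [|f]; last first.
  by case mf: (is_matching f) => //=; rewrite pE ?eqxx.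
rewrite big_mkcondr /=; apply: eq_bigr => f mf.
by rewrite prod_position_weight //; case: (admissible f c); rewrite ?mul1r ?mul0r.
Qed.

Lemma Bcoef_completions (R : comNzRingType) n (u v : R) :
  Bcoef n u v = completions false v u n.*2.+1 [:: false].
Proof.
rewrite -sum_admissible_completions; apply: eq_bigl => f.
by case mf: (is_matching f) => //=; rewrite admissible_indecomposable.
Qed.

Lemma Ccoef_completions (R : comNzRingType) n (u v : R) :
  Ccoef n u v = completions true v u n.*2.+1 [:: false].
Proof.
rewrite -sum_admissible_completions; apply: eq_bigl => f.
case mf: (is_matching f) => //=.
by apply/(connected_no_closed_interval mf)/(admissible_no_closed_interval mf).
Qed.

(* Coefficient of z^n on both sides of
     B(z,u,v) = u + z B(z,1+uv,v) B(z,u,v)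
     C(z,u,v) = u + z (C(z,1+uv,v) - C(z,1,v)) C(z,u,v),
   for u v in an arbitrary commutative ring (hence as polynomial identities). *)
Theorem theorem6p4 (R : comNzRingType) (u v : R) (n : nat) :
  Bcoef n u v =
    (if n == 0%N then u else 0)
    + \sum_(i < n) Bcoef i (1 + u * v) v * Bcoef (n.-1 - i) u v
  /\
  Ccoef n u v =
    (if n == 0%N then u else 0)
    + \sum_(i < n) (Ccoef i (1 + u * v) v - Ccoef i 1 v) * Ccoef (n.-1 - i) u v.
Proof.
split.
  rewrite Bcoef_completions completions_recursion; congr (_ + _).
  by apply: eq_bigr => i _; rewrite !Bcoef_completions mul0r subr0.
rewrite Ccoef_completions completions_recursion; congr (_ + _).
by apply: eq_bigr => i _; rewrite !Ccoef_completions mul1r.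
Qed.
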